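(* Let $X$ be a locally compact, connected Hausdorff space. (I) A singleton-finite deficient topological measure $\nu$ on $X$ is proper if and only if for every compact $K\subseteq X$ and every $\epsilon>0$ there are finitely many compact sets $K_1,\ldots,K_n$ such that $K=\bigcup_{i=1}^nK_i$ and $\sum_{i=1}^n\nu(K_i)<\epsilon$. (II) A finite deficient topological measure $\nu$ on $X$ is proper if and only if for every $\epsilon>0$ there are finitely many open sets $U_1,\ldots,U_n$ such that $X=\bigcup_{i=1}^nU_i$ and $\sum_{i=1}^n\nu(U_i)<\epsilon$.
   Context: $\mathscr{O}(X)$, $\mathscr{C}(X)$, $\mathscr{K}(X)$ denote the collections of open, closed, compact subsets of $X$; $\sqcup$ denotes a disjoint union. Set functions into the extended reals are assumed not identically $\infty$. A deficient topological measure is $\nu:\mathscr{C}(X)\cup\mathscr{O}(X)\to[0,\infty]$ such that: $\nu(C\sqcup K)=\nu(C)+\nu(K)$ for disjoint compact $C,K$; $\nu(U)=\sup\{\nu(C): C\subseteq U, C\in\mathscr{K}(X)\}$ for $U$ open; $\nu(F)=\inf\{\nu(U): F\subseteq U, U\in\mathscr{O}(X)\}$ for $F$ closed. It is singleton-finite if $\nu(\{x\})<\infty$ for all $x\in X$, and finite if $\nu(X)<\infty$. A Radon measure is a Borel measure that is finite on compact sets, outer regular on all Borel sets (by open sets), and inner regular on all open sets (by compact sets). A deficient topological measure $\nu$ is proper if $m\le\nu$ on $\mathscr{O}(X)\cup\mathscr{C}(X)$ with $m$ a Radon measure implies $m=0$. *)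

(* Defs.v *)
From HB Require Import structures.
From mathcomp Require Import all_boot all_order all_algebra.
From mathcomp Require Import all_classical all_reals all_analysis.

Set Implicit Arguments.
Unset Strict Implicit.
Unset Printing Implicit Defensive.

Import Order.TTheory GRing.Theory Num.Theory.
Local Open Scope classical_set_scope.
Local Open Scope ring_scope.
Local Open Scope ereal_scope.

(* The Borel sigma-algebra of X.  [measurableType] requires a pointed carrier,
   hence [ptopologicalType]; the distinguished point plays no role. *)
Notation borelType X := (g_sigma_algebraType (@open X)).

Definition outer_regular_on (R : realType) (X : topologicalType)
    (mu : set X -> \bar R) (A : set X) : Prop :=
  mu A = ereal_inf [set mu U | U in [set U | open U /\ A `<=` U]].

Definition inner_regular_on (R : realType) (X : topologicalType)
    (mu : set X -> \bar R) (A : set X) : Prop :=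
  mu A = ereal_sup [set mu C | C in [set C | compact C /\ C `<=` A]].

(* A deficient topological measure is a function on the open and closed sets
   only; it is represented by a total function on [set X] whose values at
   other sets are unconstrained and never used. *)
Record deficient_topological_measure (R : realType) (X : topologicalType)
    (nu : set X -> \bar R) : Prop := DeficientTopologicalMeasure {
  dtm_ge0 : forall A, open A \/ closed A -> 0 <= nu A ;
  dtm_not_infty : exists2 A, open A \/ closed A & nu A < +oo ;
  dtm_additive : forall C K, compact C -> compact K -> C `&` K = set0 ->
    nu (C `|` K) = nu C + nu K ;
  dtm_inner_regular : forall U, open U -> inner_regular_on nu U ;
  dtm_outer_regular : forall F, closed F -> outer_regular_on nu F }.

Definition singleton_finite (R : realType) (X : topologicalType)
    (nu : set X -> \bar R) : Prop :=
  forall x : X, nu [set x] < +oo.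

Definition finite_dtm (R : realType) (X : topologicalType)
    (nu : set X -> \bar R) : Prop :=
  nu [set: X] < +oo.

Record radon_measure (R : realType) (X : ptopologicalType)
    (m : {measure set (borelType X) -> \bar R}) : Prop := RadonMeasure {
  radon_compact_finite : forall K : set X, compact K -> m K < +oo ;
  radon_outer_regular : forall B : set (borelType X), measurable B ->
    outer_regular_on (X := X) m B ;
  radon_inner_regular : forall U : set X, open U ->
    inner_regular_on (X := X) m U }.

Definition proper_dtm (R : realType) (X : ptopologicalType)
    (nu : set X -> \bar R) : Prop :=
  forall m : {measure set (borelType X) -> \bar R}, radon_measure m ->
    (forall A : set X, open A \/ closed A -> m A <= nu A) ->
    forall B : set (borelType X), measurable B -> m B = 0.

(* Main.v *)
Require Import Defs.
From HB Require Import structures.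
From mathcomp Require Import all_boot all_order all_algebra.
From mathcomp Require Import all_classical all_reals all_analysis.
From mathcomp Require Import lra.

Set Implicit Arguments.
Unset Strict Implicit.
Unset Printing Implicit Defensive.

Import Order.TTheory GRing.Theory Num.Theory.
Local Open Scope classical_set_scope.
Local Open Scope ring_scope.
Local Open Scope ereal_scope.

(** A cover with a small sum makes any Borel measure below [nu] small, so the
covering conditions force a Radon measure below [nu] to vanish: on compact sets,
hence everywhere by inner regularity, in (I), and directly on [X] in (II).

For the converse, let [cover_content nu A] be the infimum of the sums
[\sum_(L <- s) nu L] over the finite sequences [s] of compact sets covering [A].
It is always monotone and subadditive. It is moreover additive on disjoint
compact sets, because cutting a cover of [C `|` D] along [C] and [D] costs
nothing: [nu (L `&` C) + nu (L `&` D) <= nu L] by additivity and monotonicity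
of [nu] ([cover_content_compact_content]). It is thus a content in the sense of
Halmos, and generates a Borel measure which is outer regular by construction
([content_radon_measure]). As [cover_content nu <= nu] on compact sets,
regularity of [nu] propagates the inequality to open and closed sets, and
singleton-finiteness makes the measure finite on compact sets. The result is a
Radon measure below [nu] that dominates [cover_content nu] on compact sets; if
[nu] is proper it vanishes, so [cover_content nu K = 0] for compact [K], which
is the covering condition of (I).

For (II), inner regularity at [X] gives a compact [C] with [nu C] close to
[nu X]; superadditivity of [nu] then makes the open set [~` C] small. Apply (I)
to [C], enlarge the compact pieces to open sets by outer regularity, and add
[~` C] to the cover. *)

(** * Adding a constant to an infimum or a supremum *)

Lemma lee_inf_addr (R : realType) (S : set (\bar R)) (x y : \bar R) :
  0 <= y -> lbound S 0 -> (forall a, S a -> x <= a + y) ->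
  x <= ereal_inf S + y.
Proof.
move=> y0 S0 Sx; have iS0 : 0 <= ereal_inf S by exact: le_ereal_inf_tmp.
have [->|yoo] := eqVneq y +oo.
  by rewrite addey ?leey// -ltNye (lt_le_trans _ iS0).
have fy : y \is a fin_num by rewrite ge0_fin_numE// ltey.
rewrite -leeBlDr//; apply: le_ereal_inf_tmp => a Sa.
by rewrite leeBlDr//; exact: Sx.
Qed.

Lemma gee_sup_addr (R : realType) (S : set (\bar R)) (x y : \bar R) :
  0 <= y -> S 0 -> (forall a, S a -> a + y <= x) -> ereal_sup S + y <= x.
Proof.
move=> y0 S0 Sx; have [yoo|yoo] := eqVneq y +oo.
  by have := Sx _ S0; rewrite yoo add0e leye_eq => /eqP ->; exact: leey.
have fy : y \is a fin_num by rewrite ge0_fin_numE// ltey.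
rewrite -leeBrDr//; apply: ge_ereal_sup => a Sa.
by rewrite leeBrDr//; exact: Sx.
Qed.

(** * Compact sets in regular spaces *)

(** Induction on compact sets: a property of sets which is hereditary, stable
under finite unions and true near each point of [K] holds of [K]. The sets
[A] such that [P (K `\` A)] form a filter containing [K]; were it proper, a
cluster point in [K] would contradict the local hypothesis. *)
Lemma compact_ind (X : topologicalType) (P : set X -> Prop) (K : set X) :
    compact K -> P set0 ->
    (forall A B, A `<=` B -> P B -> P A) ->
    (forall A B, P A -> P B -> P (A `|` B)) ->
    (forall x, K x -> exists2 V, nbhs x V & P V) ->
  P K.
Proof.
move=> cK P0 Psub PU Ploc; apply: contrapT => nPK.
pose F : set_system X := [set A | P (K `\` A)].
have FF : ProperFilter F.
  split; first by rewrite /F/= setD0.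
  split.
  - by rewrite /F/= setDT.
  - by move=> A B FA FB; rewrite /F/= setDIr; exact: PU.
  - by move=> A B AB; apply: Psub => x [Kx nBx]; split => // /AB.
have FK : F K by rewrite /F/= setDv.
have [p [Kp clp]] := cK F FF FK.
have [V pV PV] := Ploc p Kp.
have FV : F (~` V) by apply: Psub PV => x [_]; rewrite /setC/= notK.
by have [x []] := clp _ _ FV pV.
Qed.

Lemma locally_compact_regular (X : topologicalType) :
  locally_compact [set: X] -> hausdorff_space X -> regular_space X.
Proof.
move=> lcX hX x; have [U] := lcX x I; rewrite withinET => xU [cU _].
exact: compact_regular cU xU.
Qed.

Lemma regular_closed_nbhs (X : topologicalType) (U : set X) (x : X) :
  regular_space X -> open U -> U x ->
  exists V, [/\ nbhs x V, closed V & V `<=` U].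
Proof.
move=> rX oU Ux; have [W xW WU] := rX x U (open_nbhs_nbhs (conj oU Ux)).
exists (closure W); split => //; last exact: closed_closure.
by apply: filterS xW; exact: subset_closure.
Qed.

(** Compactness and regularity let a compact set covered by open sets be cut into
finitely many closed pieces subordinate to the cover. This is the topological
input of subadditivity of the measure built from a content. *)
Lemma compact_sub_bigcup_shrink (X : topologicalType) (U : nat -> set X)
    (C : set X) :
    regular_space X -> (forall n, open (U n)) -> compact C ->
    C `<=` \bigcup_n U n ->
  exists (F : nat -> set X) (N : nat),
    [/\ (forall n, closed (F n)), (forall n, F n `<=` U n) &
        C `<=` \bigcup_(n < N) F n].
Proof.
move=> rX oU cC CU.
pose P A := exists (F : nat -> set X) (N : nat),
  [/\ (forall n, closed (F n)), (forall n, F n `<=` U n) &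
      A `<=` \bigcup_(n < N) F n].
apply: (@compact_ind _ P) => //.
- by exists (fun=> set0), 0%N; split => [n|n|];
    [exact: closed0|exact: sub0set|exact: sub0set].
- move=> A B AB [F [N [clF FU BF]]]; exists F, N; split => //.
  exact: subset_trans BF.
- move=> A B [F [N [clF FU AF]]] [G [M [clG GU BG]]].
  exists (fun n => F n `|` G n), (maxn N M); split.
  + by move=> n; exact: closedU.
  + by move=> n; rewrite subUset; split.
  + move=> x [/AF|/BG] [n /= nN xn]; exists n => /=; [|by left| |by right].
      by rewrite leq_max nN.
    by rewrite leq_max nN orbT.
- move=> x /CU[k _ Ukx].
  have [V [xV clV VU]] := regular_closed_nbhs rX (oU k) Ukx.
  exists V => //; exists (fun n => if n == k then V else set0), k.+1; split.
  + by move=> n; case: eqP => // _; exact: closed0.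
  + by move=> n; case: eqP => [->//|_]; exact: sub0set.
  + by move=> y Vy; exists k => //=; rewrite eqxx.
Qed.

(** * From a content on compact sets to a Radon measure *)

Record compact_content (R : realType) (X : topologicalType)
    (lam : set X -> \bar R) : Prop := CompactContent {
  content_ge0 : forall C, compact C -> 0 <= lam C ;
  content0 : lam set0 = 0 ;
  content_le : forall C D, compact C -> compact D -> C `<=` D ->
    lam C <= lam D ;
  content_leU : forall C D, compact C -> compact D ->
    lam (C `|` D) <= lam C + lam D ;
  content_geU : forall C D, compact C -> compact D -> C `&` D = set0 ->
    lam C + lam D <= lam (C `|` D) }.

Definition inner_content (R : realType) (X : topologicalType)
    (lam : set X -> \bar R) (U : set X) : \bar R :=
  ereal_sup [set lam C | C in [set C | compact C /\ C `<=` U]].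

Definition content_outer (R : realType) (X : topologicalType)
    (lam : set X -> \bar R) (A : set X) : \bar R :=
  ereal_inf [set inner_content lam U | U in [set U | open U /\ A `<=` U]].

Section content_extension.
Context {R : realType} {X : topologicalType} {lam : set X -> \bar R}.
Hypothesis lamP : compact_content lam.
Local Notation inn := (inner_content lam).
Local Notation out := (content_outer lam).

Lemma inner_content_ge U C : compact C -> C `<=` U -> lam C <= inn U.
Proof. by move=> cC CU; apply: ereal_sup_ubound; exists C. Qed.

Lemma le_inner_content U V : U `<=` V -> inn U <= inn V.
Proof.
move=> UV; apply: ge_ereal_sup => _ [C [cC CU] <-].
by apply: inner_content_ge => //; exact: subset_trans UV.
Qed.

Lemma inner_content_ge0 U : 0 <= inn U.
Proof.
by rewrite -(content0 lamP) inner_content_ge//; exact: compact0.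
Qed.

Lemma content_outer_le A U : open U -> A `<=` U -> out A <= inn U.
Proof. by move=> oU AU; apply: ereal_inf_lbound; exists U. Qed.

Lemma content_outer_ge0 A : 0 <= out A.
Proof.
by apply: le_ereal_inf_tmp => _ [U _ <-]; exact: inner_content_ge0.
Qed.

Lemma content_outer_open U : open U -> out U = inn U.
Proof.
move=> oU; apply/eqP; rewrite eq_le content_outer_le//=.
by apply: le_ereal_inf_tmp => _ [V [_ UV] <-]; exact: le_inner_content.
Qed.

Lemma content_outer0 : out set0 = 0.
Proof.
apply/eqP; rewrite eq_le content_outer_ge0 andbT.
apply: le_trans (content_outer_le open0 (@subset_refl _ _)) _.
apply: ge_ereal_sup => _ [C [_ C0] <-].
by move: C0; rewrite subset0 => ->; rewrite (content0 lamP).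
Qed.

Lemma le_content_outer A B : A `<=` B -> out A <= out B.
Proof.
move=> AB; apply: le_ereal_inf_tmp => _ [U [oU BU] <-].
by apply: content_outer_le => //; exact: subset_trans BU.
Qed.

Lemma content_le_outer C : compact C -> lam C <= out C.
Proof.
by move=> cC; apply: le_ereal_inf_tmp => _ [U [_ CU] <-];
  exact: inner_content_ge.
Qed.

Lemma content_le_sum (C : nat -> set X) N : (forall n, compact (C n)) ->
  lam (\bigcup_(n < N) C n) <= \sum_(n < N) lam (C n).
Proof.
move=> cC; rewrite bigcup_mkord; elim: N => [|N IHN].
  by rewrite !big_ord0 (content0 lamP).
rewrite !big_ord_recr/=; apply: (le_trans (content_leU lamP _ _)) => //.
  exact: bigsetU_compact.
exact: leeD2r.
Qed.

Hypothesis rX : regular_space X.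

(** A compact subset of the union splits into finitely many compact pieces, each
inside one [U n], and [lam] is subadditive on those. *)
Lemma inner_content_sigma_subadditive (U : nat -> set X) :
  (forall n, open (U n)) -> inn (\bigcup_n U n) <= \sum_(n <oo) inn (U n).
Proof.
move=> oU; apply: ge_ereal_sup => _ [C [cC CU] <-].
have [F [N [clF FU CF]]] := compact_sub_bigcup_shrink rX oU cC CU.
have cCF n : compact (C `&` F n) by exact: compact_closedI.
have -> : C = \bigcup_(n < N) (C `&` F n).
  by rewrite -setI_bigcupr; apply/esym/setIidPl.
rewrite (le_trans (content_le_sum _ cCF))//.
rewrite -(big_mkord xpredT (fun n => lam (C `&` F n))).
apply: le_trans (@nneseries_lim_ge _ _ xpredT 0 N _); last first.
  by move=> n _ _; exact: inner_content_ge0.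
apply: lee_sum => n _; apply: inner_content_ge => //.
by apply: subset_trans (FU n); exact: subIsetr.
Qed.

Lemma content_outer_sigma_subadditive : sigma_subadditive out.
Proof.
move=> A; have [[i Aioo]|Aoo] := pselect (exists i, out (A i) = +oo).
  rewrite (nneseries_pinfty _ _ Aioo)// ?leey// => n _.
  exact: content_outer_ge0.
apply/lee_addgt0Pr => e e0.
apply: le_trans (epsilon_trick xpredT _ (ltW e0)); last first.
  by move=> n; exact: content_outer_ge0.
pose P n V := [/\ open V, A n `<=` V &
  inn V <= out (A n) + (e / (2 ^ n.+1)%:R)%:E].
have [U PU] : {U : nat -> set X & forall n, P n (U n)}.
  apply: (@choice _ _ P) => n.
  have en0 : (0 < e / (2 ^ n.+1)%:R)%R by rewrite divr_gt0// ltr0n expn_gt0.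
  have fA : out (A n) \is a fin_num.
    rewrite ge0_fin_numE ?content_outer_ge0// ltey.
    by apply/eqP => Anoo; apply: Aoo; exists n.
  have [_ [V [oV AV] <-] /ltW VA] := lb_ereal_inf_adherent en0 fA.
  by exists V.
have oU n : open (U n) by case: (PU n).
apply: (@le_trans _ _ (inn (\bigcup_n U n))).
  apply: content_outer_le; first exact: bigcup_open.
  by apply: subset_bigcup => n _; case: (PU n).
apply: le_trans (inner_content_sigma_subadditive oU) _.
apply: lee_nneseries => n *; first exact: inner_content_ge0.
by case: (PU n).
Qed.

(** The bundled form gives access to the theory of Caratheodory measurable
sets. *)
Definition content_outer_measure : {outer_measure set X -> \bar R} :=
  HB.pack_for (outer_measure R X) out
    (isOuterMeasure.Build R X out content_outer0 content_outer_ge0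
       le_content_outer content_outer_sigma_subadditive).

Hypothesis hX : hausdorff_space X.

(** It suffices to split an open set [V] along [U]. Exhaust [V `&` U] by a compact
[C] first, and only then the open set [V `\` C], which contains [V `\` U], by a
compact [D]: [C] and [D] are disjoint inside [V], where [lam] is additive. *)
Lemma open_caratheodory U : open U -> out.-caratheodory U.
Proof.
move=> oU; apply: (@le_caratheodory_measurable _ _ content_outer_measure) => A.
apply: le_ereal_inf_tmp => _ [V [oV AV] <-].
apply: (@le_trans _ _ (inn (V `&` U) + out (V `\` U))).
  apply: leeD.
    apply: content_outer_le; first exact: openI.
    exact: setSI.
  by apply: le_content_outer; exact: setSI.
have S0 W : [set lam C | C in [set C | compact C /\ C `<=` W]] 0.
  by exists set0; [split => //; exact: compact0 | exact: content0 lamP].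
apply: gee_sup_addr; [exact: content_outer_ge0 | exact: S0 |].
move=> _ [C [cC CVU] <-]; have clC := compact_closed hX cC.
have oVC : open (V `\` C) by apply: openI => //; exact: closed_openC.
apply: (@le_trans _ _ (inn (V `\` C) + lam C)).
  rewrite addeC leeD2r// content_outer_le// => x [Vx nUx].
  by split => // /CVU[].
apply: gee_sup_addr; [exact: content_ge0 lamP _ cC | exact: S0 |].
move=> _ [D [cD DVC] <-]; apply: le_trans (content_geU lamP cD cC _) _.
  by apply/disjoints_subset => x /DVC[].
apply: inner_content_ge; first exact: compactU.
by rewrite subUset; split => x; [move=> /DVC[] | move=> /CVU[]].
Qed.
End content_extension.

(** Halmos's construction of a regular Borel measure from a content. Finiteness on
compact sets is a local condition, hence the last hypothesis. *)
Lemma content_radon_measure (R : realType) (X : ptopologicalType)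
    (lam : set X -> \bar R) :
    regular_space X -> hausdorff_space X -> compact_content lam ->
    (forall x, exists U, [/\ open U, U x & inner_content lam U < +oo]) ->
  exists2 m : {measure set (borelType X) -> \bar R}, radon_measure m &
    m =1 content_outer lam.
Proof.
move=> rX hX lamP lamfin; pose mu := content_outer_measure lamP rX.
have bor : @measurable _ (borelType X) `<=` mu.-caratheodory.
  apply: smallest_sub => [|U oU]; last exact: open_caratheodory.
  split.
  - exact: caratheodory_measurable_set0.
  - by move=> A; rewrite setTD; exact: caratheodory_measurable_setC.
  - exact: caratheodory_measurable_bigcup.
have sadd : semi_sigma_additive (content_outer lam : set (borelType X) -> _).
  move=> F mF tF mUF.
  exact: (@caratheodory_measure_sigma_additive R X mu F
    (fun n => bor _ (mF n)) tF (bor _ mUF)).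
pose m : {measure set (borelType X) -> \bar R} :=
  HB.pack_for {measure set (borelType X) -> \bar R}
    (content_outer lam : set (borelType X) -> \bar R)
    (isMeasure.Build _ (borelType X) R
       (content_outer lam : set (borelType X) -> \bar R)
       (content_outer0 lamP) (content_outer_ge0 lamP) sadd).
exists m => //; split.
- move=> K cK; apply: (@compact_ind _ (fun A => mu A < +oo)) => //.
  + by rewrite outer_measure0.
  + by move=> A B AB; apply: le_lt_trans; exact: le_outer_measure.
  + move=> A B Aoo Boo; apply: le_lt_trans (outer_measureU2 mu A B) _.
    exact: lte_add_pinfty.
  + move=> x _; have [U [oU Ux Uoo]] := lamfin x.
    exists U; first exact: open_nbhs_nbhs.
    by rewrite [mu U]content_outer_open.
- move=> B _; rewrite /outer_regular_on.
  rewrite [LHS]/(content_outer lam B) /content_outer.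
  congr ereal_inf; apply: eq_imagel => U [oU _].
  exact/esym/content_outer_open.
- move=> U oU; rewrite /inner_regular_on [LHS](content_outer_open oU).
  apply/eqP; rewrite eq_le; apply/andP; split;
    apply: ge_ereal_sup => _ [C [cC CU] <-].
    apply: (le_trans (content_le_outer cC)).
    by apply: ereal_sup_ubound; exists C.
  rewrite -(content_outer_open oU).
  exact: le_content_outer.
Qed.

(** * Deficient topological measures and their covering contents *)

(** Covers need only contain [A], which makes monotonicity immediate; cutting a
cover down to [A] costs nothing (see [compact_seq_coverI]). *)
Definition compact_seq_cover (X : topologicalType) (A : set X) :
    set (seq (set X)) :=
  [set s | (forall L, L \in s -> compact L) /\
           A `<=` \bigcup_(L in [set` s]) L].

Definition cover_content (R : realType) (X : topologicalType)
    (nu : set X -> \bar R) (A : set X) : \bar R :=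
  ereal_inf [set \sum_(L <- s) nu L | s in compact_seq_cover A].

Section dtm.
Context {R : realType} {X : topologicalType} {nu : set X -> \bar R}.
Hypothesis hX : hausdorff_space X.
Hypothesis nuP : deficient_topological_measure nu.

Lemma dtm_compact_ge0 C : compact C -> 0 <= nu C.
Proof. by move=> /(compact_closed hX) clC; apply: (dtm_ge0 nuP); right. Qed.

(** The two regularity conditions define [nu] on open sets from smaller compact
sets and on closed sets from larger open sets; monotonicity follows. *)
Lemma dtm_le_open A U : open A \/ closed A -> open U -> A `<=` U ->
  nu A <= nu U.
Proof.
move=> [oA|clA] oU AU; last first.
  by rewrite (dtm_outer_regular nuP clA); apply: ereal_inf_lbound; exists U.
rewrite (dtm_inner_regular nuP oA) (dtm_inner_regular nuP oU).
apply: ge_ereal_sup => _ [C [cC CA] <-]; apply: ereal_sup_ubound.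
by exists C => //; split => //; exact: subset_trans AU.
Qed.

Lemma dtm_le A B : open A \/ closed A -> open B \/ closed B -> A `<=` B ->
  nu A <= nu B.
Proof.
move=> ocA [oB|clB] AB; first exact: dtm_le_open.
rewrite (dtm_outer_regular nuP clB).
apply: le_ereal_inf_tmp => _ [U [oU BU] <-]; apply: dtm_le_open => //.
exact: subset_trans BU.
Qed.

(** Additivity only gives [nu set0 + nu set0 = nu set0]; the value [+oo] is
excluded because [nu] is finite somewhere and monotone. *)
Lemma dtm0 : nu set0 = 0.
Proof.
have [A ocA Aoo] := dtm_not_infty nuP.
have nu0 : nu set0 \is a fin_num.
  rewrite ge0_fin_numE; last by apply: dtm_compact_ge0; exact: compact0.
  apply: le_lt_trans Aoo; apply: dtm_le => //; first by left; exact: open0.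
have := dtm_additive nuP (@compact0 X) (@compact0 X) (setI0 _).
rewrite setU0 -(fineK nu0) -EFinD => -[/eqP].
by rewrite eq_sym -subr_eq0 addrK => /eqP ->.
Qed.

Lemma compact_seq_sum_ge0 s : (forall L, L \in s -> compact L) ->
  0 <= \sum_(L <- s) nu L.
Proof.
by move=> sc; rewrite big_seq; apply: sume_ge0 => L /sc; exact: dtm_compact_ge0.
Qed.

Lemma cover_content_le_sum A s : compact_seq_cover A s ->
  cover_content nu A <= \sum_(L <- s) nu L.
Proof. by move=> As; apply: ereal_inf_lbound; exists s. Qed.

Lemma cover_content_ge0 A : 0 <= cover_content nu A.
Proof.
by apply: le_ereal_inf_tmp => _ [s [sc _] <-]; exact: compact_seq_sum_ge0.
Qed.

Lemma cover_content_le_dtm C : compact C -> cover_content nu C <= nu C.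
Proof.
move=> cC; rewrite -[leRHS](big_seq1 +%E C nu); apply: cover_content_le_sum.
split=> [L|x Cx]; first by rewrite inE => /eqP ->.
by exists C => //=; rewrite mem_head.
Qed.

Lemma compact_seq_coverI (A C : set X) s : closed C -> compact_seq_cover A s ->
  C `<=` A -> compact_seq_cover C [seq L `&` C | L <- s].
Proof.
move=> clC [sc As] CA; split=> [_ /mapP[L /sc cL ->]|x Cx].
  exact: compact_closedI.
have [L Ls Lx] := As x (CA x Cx).
by exists (L `&` C) => //=; exact: map_f.
Qed.

(** The one substantial point is superadditivity on disjoint compact sets: a cover
of [C `|` D] induces covers of [C] and [D] by intersection, and the two traces of
a piece [L] are disjoint compact subsets of [L]. *)
Lemma cover_content_compact_content : compact_content (cover_content nu).
Proof.
split.
- by move=> C _; exact: cover_content_ge0.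
- apply/eqP; rewrite eq_le cover_content_ge0 andbT -dtm0.
  exact/cover_content_le_dtm/compact0.
- move=> C D _ _ CD; apply: le_ereal_inf_tmp => _ [s [sc Ds] <-].
  by apply: cover_content_le_sum; split => //; exact: subset_trans Ds.
- move=> C D _ _.
  have lb0 A : lbound [set \sum_(L <- s) nu L | s in compact_seq_cover A] 0.
    by move=> _ [s [sc _] <-]; exact: compact_seq_sum_ge0.
  apply: lee_inf_addr; [exact: cover_content_ge0 | exact: lb0 |].
  move=> _ [s [sc Cs] <-]; rewrite addeC.
  apply: lee_inf_addr; [exact: compact_seq_sum_ge0 | exact: lb0 |].
  move=> _ [t [tc Dt] <-]; rewrite addeC -big_cat; apply: cover_content_le_sum.
  split=> [L|x]; first by rewrite mem_cat => /orP[/sc|/tc].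
  by move=> [/Cs|/Dt] [L /= Lst Lx]; exists L => //=; rewrite mem_cat Lst ?orbT.
- move=> C D cC cD CD0; apply: le_ereal_inf_tmp => _ [s CDs <-].
  have [clC clD] := (compact_closed hX cC, compact_closed hX cD).
  apply: (@le_trans _ _ (\sum_(L <- s) (nu (L `&` C) + nu (L `&` D)))).
    rewrite big_split; apply: leeD.
      rewrite -(big_map (setI^~ C) xpredT nu); apply: cover_content_le_sum.
      exact: compact_seq_coverI CDs (@subsetUl _ C D).
    rewrite -(big_map (setI^~ D) xpredT nu); apply: cover_content_le_sum.
    exact: compact_seq_coverI CDs (@subsetUr _ C D).
  rewrite big_seq [leRHS]big_seq; apply: lee_sum => L /(proj1 CDs) cL.
  have [cLC cLD] : compact (L `&` C) /\ compact (L `&` D).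
    by split; exact: compact_closedI.
  rewrite -(dtm_additive nuP cLC cLD); last by rewrite setIACA CD0 setI0.
  have clL := compact_closed hX cL.
  apply: dtm_le; [right| by right|by rewrite -setIUr; exact: subIsetl].
  by apply: closedU; exact: closedI.
Qed.

Lemma inner_cover_content_le_dtm U : open U ->
  inner_content (cover_content nu) U <= nu U.
Proof.
move=> oU; apply: ge_ereal_sup => _ [C [cC CU] <-].
apply: le_trans (cover_content_le_dtm cC) _; apply: dtm_le => //.
- by right; exact: compact_closed.
- by left.
Qed.

Lemma cover_content_outer_le_dtm A : open A \/ closed A ->
  content_outer (cover_content nu) A <= nu A.
Proof.
move=> [oA|clA].
  by rewrite content_outer_open//; exact: inner_cover_content_le_dtm.
rewrite (dtm_outer_regular nuP clA).
apply: le_ereal_inf_tmp => _ [U [oU AU] <-].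
exact: le_trans (content_outer_le oU AU) (inner_cover_content_le_dtm oU).
Qed.

Lemma singleton_finite_nbhs : singleton_finite nu -> forall x, exists U,
  [/\ open U, U x & nu U < +oo].
Proof.
move=> nuf x; have := nuf x.
rewrite (dtm_outer_regular nuP (compact_closed hX (@compact_set1 X x))).
move=> /ereal_inf_lt[_ [U [oU xU] <-] Uoo]; exists U; split => //.
exact: xU.
Qed.

(** The complement of [C] is exhausted by compact sets [D] disjoint from [C], for
which additivity applies. *)
Lemma dtm_superadditive C : compact C -> nu (~` C) + nu C <= nu setT.
Proof.
move=> cC; have clC := compact_closed hX cC.
rewrite (dtm_inner_regular nuP (closed_openC clC)).
apply: gee_sup_addr; first exact: dtm_compact_ge0.
  by exists set0; [split => //; exact: compact0 | exact: dtm0].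
move=> _ [D [cD DC] <-]; rewrite -(dtm_additive nuP cD cC).
  by apply: dtm_le => //; [right; apply: closedU => //; exact: compact_closed
    | left; exact: openT].
exact/disjoints_subset.
Qed.

(** Outer regularity, piece by piece; finiteness of [nu L] is what lets the error be
prescribed. *)
Lemma open_seq_cover s (d : R) : (0 < d)%R ->
  (forall L, L \in s -> closed L) -> (forall L, L \in s -> nu L < +oo) ->
  exists t : seq (set X), [/\ (forall U, U \in t -> open U),
    \bigcup_(L in [set` s]) L `<=` \bigcup_(U in [set` t]) U &
    \sum_(U <- t) nu U <= \sum_(L <- s) nu L + d%:E].
Proof.
elim: s d => [|L s IHs] d d0 clLs Lsoo.
  exists [::]; split => //.
  by rewrite !big_nil add0e lee_fin ltW.
have d20 : (0 < d / 2)%R by rewrite divr_gt0.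
have [||t [ot st tle]] := IHs _ d20.
- by move=> M Ms; apply: clLs; rewrite inE Ms orbT.
- by move=> M Ms; apply: Lsoo; rewrite inE Ms orbT.
have clL : closed L by apply: clLs; rewrite mem_head.
have fL : nu L \is a fin_num.
  by rewrite ge0_fin_numE ?Lsoo ?mem_head//; apply: (dtm_ge0 nuP); right.
have := dtm_outer_regular nuP clL; rewrite /outer_regular_on => LE.
move: (fL); rewrite LE => /(lb_ereal_inf_adherent d20)[_ [U [oU LU] <-]].
rewrite -LE => /ltW UL; exists (U :: t); split.
- by move=> V; rewrite inE => /predU1P[->//|]; exact: ot.
- move=> x [M /=]; rewrite inE => /predU1P[->|Ms] Mx.
    by exists U; [rewrite /= mem_head | exact: LU].
  have [V /= Vt Vx] := st x (ex_intro2 _ _ M Ms Mx).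
  by exists V => //=; rewrite inE Vt orbT.
- rewrite !big_cons (le_trans (leeD UL tle))// addeACA -EFinD -splitr.
  exact: lexx.
Qed.

End dtm.

(** * Finite covers and measures *)

Lemma seq_cover_ord (R : realType) (X : Type) (f : set X -> \bar R)
    (P : set X -> Prop) (A : set X) (e : \bar R) (s : seq (set X)) :
    (forall L, L \in s -> P L) -> A = \bigcup_(L in [set` s]) L ->
    \sum_(L <- s) f L < e ->
  exists (n : nat) (A_ : 'I_n -> set X),
    [/\ (forall i, P (A_ i)), A = \bigcup_(i in [set: 'I_n]) A_ i &
        \sum_(i < n) f (A_ i) < e].
Proof.
move=> sP As sume; exists (size s), (tnth (in_tuple s)); split.
- by move=> i; apply: sP; exact: mem_tnth.
- rewrite As; apply/seteqP; split=> x.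
    by move=> [L /= /(@tnthP _ _ (in_tuple s))[i ->] Lx]; exists i.
  by move=> [i _ ix]; exists (tnth (in_tuple s) i) => //=; exact: mem_tnth.
- by move: sume; rewrite big_tnth.
Qed.

Lemma measure_bigcup_ord_le (d : measure_display) (T : measurableType d)
    (R : realType) (m : {measure set T -> \bar R}) (n : nat)
    (A : 'I_n -> set T) : (forall i, measurable (A i)) ->
  m (\bigcup_(i in [set: 'I_n]) A i) <= \sum_(i < n) m (A i).
Proof.
move=> mA.
have -> : \bigcup_(i in [set: 'I_n]) A i = \big[setU/set0]_(i < n) A i.
  rewrite -bigcup_seq; congr (bigcup _ _).
  by apply/seteqP; split => i //= _; exact: mem_index_enum.
elim: (index_enum _) => [|i s IHs]; first by rewrite !big_nil measure0.
rewrite !big_cons; apply: (le_trans (measureU2 _ _ _)) => //.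
  exact: bigsetU_measurable.
exact: leeD2l.
Qed.

Section borel.
Context {X : ptopologicalType}.

Lemma borel_open (U : set X) : open U -> @measurable _ (borelType X) U.
Proof. exact: sub_sigma_algebra. Qed.

Lemma borel_closed (F : set X) : closed F -> @measurable _ (borelType X) F.
Proof.
by move=> /closed_openC/borel_open oF; rewrite -(setCK F); exact: measurableC.
Qed.
End borel.

(** * Proper deficient topological measures *)

Section properness.
Context {R : realType} {X : ptopologicalType} {nu : set X -> \bar R}.
Hypothesis hX : hausdorff_space X.
Hypothesis nuP : deficient_topological_measure nu.

(** The class [P] stands for the compact sets or for the open sets, so that the
lemma serves both covering conditions. *)
Lemma small_cover_measure0 (m : {measure set (borelType X) -> \bar R})
    (P : set X -> Prop) (A : set X) :
    (forall L, P L -> open L \/ closed L) ->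
    (forall A, open A \/ closed A -> m A <= nu A) ->
    (forall e : R, (0 < e)%R -> exists (n : nat) (A_ : 'I_n -> set X),
       [/\ (forall i, P (A_ i)), A = \bigcup_(i in [set: 'I_n]) A_ i &
           \sum_(i < n) nu (A_ i) < e%:E]) ->
  m A = 0.
Proof.
move=> Poc mnu Acov; apply/eqP; rewrite eq_le measure_ge0 andbT.
apply/lee_addgt0Pr => e e0; rewrite add0e.
have [n [A_ [PA -> /ltW]]] := Acov e e0; apply: le_trans.
apply: le_trans (lee_sum _ _) => [|i _]; last exact/mnu/Poc/PA.
apply: measure_bigcup_ord_le => i.
by have [|] := Poc _ (PA i); [exact: borel_open | exact: borel_closed].
Qed.

(** Properness annihilates the Radon measure generated by the covering content,
and that measure dominates the covering content on compact sets. *)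
Lemma proper_dtm_cover (K : set X) (e : R) :
    locally_compact [set: X] -> singleton_finite nu -> proper_dtm nu ->
    compact K -> (0 < e)%R ->
  exists s : seq (set X), [/\ (forall L, L \in s -> compact L),
    K = \bigcup_(L in [set` s]) L & \sum_(L <- s) nu L < e%:E].
Proof.
move=> lcX nuf nuprop cK e0.
have rX := locally_compact_regular lcX hX.
have lamP := cover_content_compact_content hX nuP.
have [|m mR mE] := content_radon_measure rX hX lamP.
  move=> x; have [U [oU Ux Uoo]] := singleton_finite_nbhs hX nuP nuf x.
  exists U; split => //; apply: le_lt_trans Uoo.
  exact: inner_cover_content_le_dtm.
have clK := compact_closed hX cK.
have mK : m K = 0.
  apply: (nuprop m mR); last exact: borel_closed.
  by move=> A ocA; rewrite mE; exact: cover_content_outer_le_dtm.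
have : cover_content nu K < e%:E.
  by rewrite (le_lt_trans (content_le_outer cK))// -mE mK lte_fin.
move=> /ereal_inf_lt[_ [s Ks <-] se].
have [sKc sK] := compact_seq_coverI clK Ks (@subset_refl _ K).
exists [seq L `&` K | L <- s]; split => //.
  by apply/seteqP; split => // x [_ /= /mapP[L _ ->] []].
rewrite big_map; apply: le_lt_trans se.
rewrite big_seq [leRHS]big_seq; apply: lee_sum => L /(proj1 Ks) cL.
have clL := compact_closed hX cL.
by apply: (dtm_le nuP); [right; exact: closedI | right | exact: subIsetl].
Qed.

End properness.

Theorem theorem4p5 (R : realType) (X : ptopologicalType)
    (X_locally_compact : locally_compact [set: X])
    (X_connected : connected [set: X])
    (X_hausdorff : hausdorff_space X) :
  (forall nu : set X -> \bar R,
     deficient_topological_measure nu -> singleton_finite nu ->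
     (proper_dtm nu <->
      (forall K : set X, compact K -> forall eps : R, (0 < eps)%R ->
         exists (n : nat) (K_ : 'I_n -> set X),
           [/\ (forall i, compact (K_ i)),
               K = \bigcup_(i in [set: 'I_n]) K_ i &
               \sum_(i < n) nu (K_ i) < eps%:E])))
  /\
  (forall nu : set X -> \bar R,
     deficient_topological_measure nu -> finite_dtm nu ->
     (proper_dtm nu <->
      (forall eps : R, (0 < eps)%R ->
         exists (n : nat) (U_ : 'I_n -> set X),
           [/\ (forall i, open (U_ i)),
               [set: X] = \bigcup_(i in [set: 'I_n]) U_ i &
               \sum_(i < n) nu (U_ i) < eps%:E]))).
Proof.
have null (m : {measure set (borelType X) -> \bar R}) :
    m [set: X] = 0 -> forall B, measurable B -> m B = 0.
  move=> mT B mB; apply/eqP; rewrite eq_le measure_ge0 andbT -mT.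
  by apply: le_measure => //; rewrite inE //; exact: measurableT.
split=> nu nuP nuf; split.
- move=> nuprop K cK e e0.
  have [s [sc Ks se]] :=
    proper_dtm_cover X_hausdorff nuP X_locally_compact nuf nuprop cK e0.
  exact: seq_cover_ord sc Ks se.
- move=> cov m mR mnu; apply: null; rewrite (radon_inner_regular mR openT).
  apply/eqP; rewrite eq_le; apply/andP; split; last first.
    by apply: ereal_sup_ubound; exists set0; [split => //; exact: compact0|].
  apply: ge_ereal_sup => _ [C [cC _] <-].
  rewrite (small_cover_measure0 _ mnu (cov C cC))// => L cL.
  by right; exact: compact_closed.
- (* The three parts of size [e / 3]: the defect of [nu C] from [nu X], the
     compact cover of [C], and its enlargement to an open cover. *)
  move=> nuprop e e0; have d0 : (0 < e / 3)%R by rewrite divr_gt0.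
  have nule A : open A \/ closed A -> nu A < +oo.
    move=> ocA; apply: le_lt_trans nuf; apply: (dtm_le nuP) => //.
    by left; exact: openT.
  have fin A : open A \/ closed A -> nu A \is a fin_num.
    by move=> ocA; rewrite ge0_fin_numE ?nule//; exact: dtm_ge0.
  have sf : singleton_finite nu.
    move=> x; apply: nule; right; apply: compact_closed => //.
    exact: compact_set1.
  have fT : nu setT \is a fin_num by apply: fin; left; exact: openT.
  have TE := dtm_inner_regular nuP (@openT X); rewrite /inner_regular_on in TE.
  move: (fT); rewrite TE => /(ub_ereal_sup_adherent d0)[_ [C [cC _] <-]].
  rewrite -TE => CT; have clC := compact_closed X_hausdorff cC.
  have CCd : nu (~` C) <= (e / 3)%:E.
    rewrite -(leeD2rE _ _ (fin C _)); last by right.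
    rewrite (le_trans (dtm_superadditive X_hausdorff nuP cC))//.
    by rewrite addeC -leeBlDr// ltW.
  have [s [sc Cs se]] :=
    proper_dtm_cover X_hausdorff nuP X_locally_compact sf nuprop cC d0.
  have scl L : L \in s -> closed L by move=> /sc; exact: compact_closed.
  have [|t [ot st te]] := open_seq_cover nuP d0 scl.
    by move=> L /scl clL; apply: nule; right.
  apply: (@seq_cover_ord _ _ _ open _ _ (~` C :: t)).
  + by move=> U; rewrite inE => /predU1P[->|/ot//]; exact: closed_openC.
  + apply/esym; rewrite -subTset => x _; have [Cx|nCx] := pselect (C x).
      move: Cx; rewrite Cs => /st[U Ut Ux]; exists U => //=.
      by rewrite inE Ut orbT.
    by exists (~` C) => //=; rewrite mem_head.
  + rewrite big_cons.
    apply: (@lt_le_trans _ _ ((e / 3)%:E + ((e / 3)%:E + (e / 3)%:E))).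
      apply: lee_ltD => //; first by apply: fin; left; exact: closed_openC.
      by apply: le_lt_trans te _; rewrite lteD2rE.
    by rewrite -!EFinD lee_fin; lra.
- move=> cov m mR mnu; apply: null.
  by apply: (small_cover_measure0 _ mnu cov) => L; left.
Qed.
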